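(* Let $X$ be a locally compact Hausdorff connected space. (s1) For any $f\in C_b(X)$ with $f\ge0$ and any constant $\delta>0$, the function $f_\delta=\inf\{f,\delta\}$ is in $S(f)$. (s2) If $f,g\in C_b(X)$, $f\cdot g=0$ and $f,g\ge0$, then $f,g\in S(f-g)$; and if $f\cdot g=0$, $f\ge0$, $g\le0$, then $f,g\in S(f+g)$. In particular, for any $f\in C_b(X)$ the functions $f^+,f^-$ and $|f|$ are in $S(f)$. (s3) If $f\in C_0(X)$ and $\epsilon>0$, then there is $h\in C_c(X)$ such that $h\in S(f)$ and $\|f-h\|\le\epsilon$. (s4) If $f,g\in C_b(X)$ and $c$ is a constant with $0\le g(x)\le f(x)\le c$ for all $x\in X$, and $f=c$ on $\{x:g(x)>0\}$, then $f,g\in S(f+g)$.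
   Context: $C_b(X)$, $C_0(X)$, $C_c(X)$ are the real-valued continuous functions on $X$ that are bounded, vanish at infinity, have compact support, respectively, with the uniform norm $\|\cdot\|$. $f^+=\max(f,0)$, $f^-=\max(-f,0)$. Singly generated subalgebra: for $f\in C_b(X)$, $S(f)$ is the smallest uniformly closed subalgebra of $C_b(X)$ containing $f$ and, if $X$ is compact, also containing the constant $1$ (if $X$ is not compact, $1$ is not required to belong to it). *)

(* Defs.v *)
From mathcomp Require Export all_boot all_order all_algebra.
From mathcomp Require Export all_classical all_reals all_analysis.
Set Implicit Arguments.
Unset Strict Implicit.
Unset Printing Implicit Defensive.
Export Order.TTheory GRing.Theory Num.Theory numFieldNormedType.Exports.
Local Open Scope classical_set_scope.
Local Open Scope ring_scope.

(* MathComp-Analysis; the algebra operations on [X -> R] are the library's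
   pointwise ones. *)

Definition Cb (X : topologicalType) (R : realType) : set (X -> R) :=
  [set f | continuous f /\ bounded_fun f].

Definition C0 (X : topologicalType) (R : realType) : set (X -> R) :=
  [set f | continuous f /\
    forall e : R, 0 < e -> compact [set x | e <= `|f x|]].

Definition Cc (X : topologicalType) (R : realType) : set (X -> R) :=
  [set f | continuous f /\ compact (closure [set x | f x != 0])].

(* [sup] is 0 on sets without supremum, so this is the uniform norm only for
   bounded [f] (and it is 0 when [X] is empty). *)
Definition unorm (X : Type) (R : realType) (f : X -> R) : R :=
  sup [set `|f x| | x in [set: X]].

(* Subalgebras are linear subspaces stable under product, not required to
   contain 1 unless [X] is compact.
   The closure is taken in the topology of uniform convergence and restricted
   to [Cb]: [A] is closed as a subset of [Cb]. *)
Definition uclosed_subalgebra (X : topologicalType) (R : realType)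
    (A : set (X -> R)) : Prop :=
  [/\ A `<=` @Cb X R,
      GRing.submod_closed [in A],
      GRing.mulr_2closed [in A],
      @Cb X R `&` closure (A : set {uniform X -> R}) `<=` A &
      compact [set: X] -> A 1].

Definition Salg (X : topologicalType) (R : realType) (f : X -> R) :
    set (X -> R) :=
  smallest (@uclosed_subalgebra X R) [set f].

(* Main.v *)
(** The polynomials q_0 = 0, q_(n+1) = q_n + (X^2 - q_n^2)/2 converge to |t|
    uniformly on [-1, 1].  After rescaling and removing the constant term they
    show that a uniformly closed subalgebra containing f, with or without 1,
    contains |f - a| - |a| for every a.  Every function to be produced is a
    linear combination of f and such functions: min(f, d) comes from a = d,
    |f| from a = 0, the soft threshold of f at level eps from a = eps and
    a = -eps, and in (s4) f = min(f + g, c). *)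
Require Import Defs.
From mathcomp Require Import ring lra.
Set Implicit Arguments.
Unset Strict Implicit.
Unset Printing Implicit Defensive.
Local Open Scope classical_set_scope.
Local Open Scope ring_scope.

(** * Polynomial approximation of the absolute value *)

Fixpoint abs_poly (R : realType) (n : nat) : {poly R} :=
  if n is n'.+1 then
    abs_poly R n' + 2^-1 *: ('X ^+ 2 - abs_poly R n' ^+ 2)
  else 0.

(** The third bound, written without division, makes the error at most [2 / n] uniformly on [-1, 1].
    With [u = |t|] and [p] the current value, one step multiplies the error by [1 - (u + p) / 2],
    and this factor times [2 + (n + 1) u] is at most [2 + n u]. *)
Lemma abs_poly_bounds (R : realType) (n : nat) (t : R) : `|t| <= 1 ->
  [/\ 0 <= (abs_poly R n).[t], (abs_poly R n).[t] <= `|t| &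
      (`|t| - (abs_poly R n).[t]) * (2 + n%:R * `|t|) <= 2 * `|t|].
Proof.
move=> t1; have t0 := normr_ge0 t.
elim: n => [|n [p0 pt pn]] /=.
  by rewrite horner0 mul0r addr0 subr0 mulrC.
rewrite !hornerE -(real_normK (num_real t)).
set u := `|t| in t0 t1 pt pn *; set p := (abs_poly R n).[t] in p0 pt pn *.
have pu : p ^+ 2 <= u ^+ 2 by rewrite lerXn2r ?nnegrE.
have E : u - (p + 2^-1 * (u ^+ 2 - p ^+ 2)) = (u - p) * (1 - (u + p) / 2).
  by field.
have d0 : 0 <= u - p by rewrite subr_ge0.
split; first by rewrite addr_ge0// mulr_ge0 ?invr_ge0// subr_ge0.
  by rewrite -subr_ge0 E mulr_ge0// subr_ge0; lra.
rewrite E; apply: le_trans pn.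
rewrite -mulrA ler_wpM2l// -[n.+1%:R]natr1.
have n0 : 0 <= n%:R * u :> R by rewrite mulr_ge0.
have : 0 <= (u + p) * (n%:R * u + u) by rewrite mulr_ge0// addr_ge0.
lra.
Qed.

Lemma shifted_abs_poly_approx (R : realType) (a M e : R) : 0 < e ->
  exists p : {poly R}, forall t, `|t| <= M -> `| `|t - a| - p.[t] | <= e.
Proof.
move=> e0.
(* [K] is positive and bounds [|t - a|], so [(t - a) / K] lies in [-1, 1]; scaling back turns the
   error [2 / n] into [2 K / n]. *)
pose K := `|M| + `|a| + 1.
have K0 : 0 < K by rewrite ltr_wpDl// addr_ge0.
have [n n0 nK] : exists2 n, 0 < n%:R :> R & 2 * K < e * n%:R.
  exists (Num.truncn (2 * K / e)).+1; first by rewrite ltr0n.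
  by rewrite [e * _]mulrC -ltr_pdivrMr// truncnS_gt.
exists (K *: (abs_poly R n \Po (K^-1 *: ('X - a%:P)))) => t tM.
rewrite !hornerE horner_comp !hornerE.
set v := K^-1 * (t - a).
have tv : `|t - a| = K * `|v|.
  by rewrite normrM gtr0_norm ?invr_gt0// mulrA divff ?mul1r// gt_eqF.
have v1 : `|v| <= 1.
  rewrite -(ler_pM2l K0) -tv mulr1 (le_trans (ler_normB _ _))//.
  have := ler_norm M; rewrite /K; lra.
have [p0 pv H] := abs_poly_bounds n v1.
set r := (abs_poly R n).[v] in p0 pv H *.
rewrite tv -mulrBr normrM (gtr0_norm K0) ger0_norm ?subr_ge0//.
(* The bound [H] yields the rate only after cancelling [|v|]. *)
have [v0|v0] := eqVneq `|v| 0.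
  have -> : r = 0 by apply/eqP; rewrite eq_le p0 -v0 pv.
  by rewrite v0 subr0 mulr0 ltW.
have {}v0 : 0 < `|v| by rewrite lt_neqAle eq_sym v0 normr_ge0.
have nr : (`|v| - r) * n%:R <= 2.
  rewrite -(ler_pM2r v0); apply: le_trans H.
  by rewrite -mulrA ler_wpM2l ?subr_ge0// lerDr.
rewrite -(ler_pM2r n0) -mulrA; apply: le_trans (ltW nK).
by rewrite mulrC (mulrC 2) mulrC ler_pM2l.
Qed.

(** * Operations under which a uniformly closed subalgebra is stable *)

Section uclosed_subalgebra.
Variables (R : realType) (X : topologicalType) (A : set (X -> R)).
Hypothesis ucA : uclosed_subalgebra A.

Lemma uclosed_subalgebra_lin (k : R) (u v : X -> R) :
  A u -> A v -> A (fun x => k * u x + v x).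
Proof.
case: ucA => _ [_ lin] _ _ _ Au Av.
by rewrite -in_setE; apply: lin; rewrite in_setE.
Qed.

Lemma uclosed_subalgebra_scale (k : R) (u : X -> R) :
  A u -> A (fun x => k * u x).
Proof.
case: (ucA) => _ [A0 _] _ _ _ Au; rewrite in_setE in A0.
congr (A _): (uclosed_subalgebra_lin k Au A0).
by apply/funext => x; rewrite [(0 : X -> R) x]/(0 : R) addr0.
Qed.

Lemma uclosed_subalgebra_sub (u v : X -> R) : A u -> A v -> A (u - v).
Proof.
move=> Au Av; congr (A _): (uclosed_subalgebra_lin (-1) Av Au).
by apply/funext => x; rewrite mulN1r addrC.
Qed.

Lemma uclosed_subalgebra_lim (g : X -> R) : Cb g ->
  (forall e, 0 < e -> exists2 h, A h & forall x, `|g x - h x| <= e) -> A g.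
Proof.
case: ucA => _ _ _ cl _ Cg gA; apply: cl; split => // P.
move=> /uniform_nbhs[E [entE EP]].
move: entE; rewrite -entourage_ballE => -[e /= e0 eE].
(* Halving [e] turns the large inequality into the strict one that defines the ball. *)
have [|h Ah hg] := gA (e / 2); first by rewrite divr_gt0.
exists h; split => //; apply: EP => x _; apply: eE => /=.
by rewrite /ball /= (le_lt_trans (hg x))// gtr_pMr// invf_lt1// ltr1n.
Qed.

(** Subtracting the constant term keeps the result in [A] even when 1 is not in [A]. In the Horner
    step, [p * 'X + c] contributes [(p.[f x] - p.[0]) * f x + p.[0] * f x]. *)
Lemma uclosed_subalgebra_poly (f : X -> R) (p : {poly R}) : A f ->
  A (fun x => p.[f x] - p.[0]).
Proof.
move=> Af; case: (ucA) => _ [A0 _] mul _ _.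
elim/poly_ind: p => [|p c IH].
  rewrite in_setE in A0; congr (A _): A0.
  by apply/funext => x; rewrite !horner0 subr0.
have pf : A ((fun x => p.[f x] - p.[0]) * f).
  by rewrite -in_setE; apply: mul; rewrite in_setE.
congr (A _): (uclosed_subalgebra_lin p.[0] Af pf).
apply/funext => x; rewrite !hornerE.
by rewrite [X in _ + X](_ : _ = (p.[f x] - p.[0]) * f x)//; ring.
Qed.

Lemma uclosed_subalgebra_abs (f : X -> R) (a : R) : A f ->
  A (fun x => `|f x - a| - `|a|).
Proof.
move=> Af.
have [Cf [M [_ fM]]] : Cb f by case: ucA => + _ _ _ _; exact.
have {}fM x : `|f x| <= M + 1 by apply: fM => //; rewrite ltrDl.
have gM x : `| `|f x - a| - `|a| | <= M + 1.
  by rewrite -[`|a|]normrN (le_trans (ler_dist_dist _ _))// opprK subrK.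
apply: uclosed_subalgebra_lim.
  split.
    move=> x; apply: cvgB; last exact: cvg_cst.
    by apply: cvg_norm; apply: cvgB; [exact: Cf|exact: cvg_cst].
  exists (M + 1); split; first exact: num_real.
  by move=> B MB x _; exact: le_trans (gM x) (ltW MB).
move=> e e0.
(* The error [e / 2] is spent twice: at [f x], and at 0 for the subtracted constant term. The point
   0 is in the range of approximation because [|f x| <= M + 1] forces [0 <= M + 1]. *)
have [|p pa] := @shifted_abs_poly_approx R a (M + 1) (e / 2).
  by rewrite divr_gt0.
exists (fun x => p.[f x] - p.[0]); first exact: uclosed_subalgebra_poly.
move=> x; have M0 : `|0 : R| <= M + 1.
  by rewrite normr0; exact: le_trans (fM x).
have := pa _ (fM x); have := pa _ M0; rewrite sub0r normrN !ler_norml.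
by move=> /andP[? ?] /andP[? ?]; apply/andP; split; lra.
Qed.

(** As [c = |c|], the minimum is [(f - (|f - c| - |c|)) / 2], with no stray constant. *)
Lemma uclosed_subalgebra_min (f : X -> R) (c : R) : 0 <= c -> A f ->
  A (fun x => Num.min (f x) c).
Proof.
move=> c0 Af; have := uclosed_subalgebra_abs c Af.
move=> /(uclosed_subalgebra_lin (-1))/(_ Af)/(uclosed_subalgebra_scale 2^-1) H.
congr (A _): H; apply/funext => x; rewrite (ger0_norm c0) minr_absE.
by field.
Qed.

Lemma uclosed_subalgebra_norm (f : X -> R) : A f -> A (fun x => `|f x|).
Proof.
move=> Af; congr (A _): (uclosed_subalgebra_abs 0 Af).
by apply/funext => x; rewrite normr0 !subr0.
Qed.

Lemma uclosed_subalgebra_funrpos (f : X -> R) : A f -> A f^\+.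
Proof.
move=> Af; have := uclosed_subalgebra_norm Af.
move=> /(uclosed_subalgebra_lin 1)/(_ Af)/(uclosed_subalgebra_scale 2^-1) H.
congr (A _): H; apply/funext => x; rewrite /funrpos.
by case: ger0P => _; field.
Qed.

Lemma uclosed_subalgebra_funrneg (f : X -> R) : A f -> A f^\-.
Proof.
move=> /(uclosed_subalgebra_scale (-1))/uclosed_subalgebra_funrpos H.
by congr (A _): H; apply/funext => x; rewrite /funrpos mulN1r.
Qed.

End uclosed_subalgebra.

(** * Soft thresholding *)

(** For [e > 0] this is 0 on [[-e, e]] and moves every other [t] towards 0 by [e]. *)
Definition soft_threshold (R : realType) (e t : R) : R :=
  t + (`|t - e| - `|t + e|) / 2.

Lemma soft_threshold_dist (R : realType) (e t : R) : 0 < e ->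
  `|t - soft_threshold e t| <= e.
Proof.
move=> e0; rewrite /soft_threshold opprD addNKr normrN ler_norml.
by case: ger0P => ?; case: ger0P => ?; apply/andP; split; lra.
Qed.

Lemma soft_threshold_neq0 (R : realType) (e t : R) : 0 < e ->
  soft_threshold e t != 0 -> e <= `|t|.
Proof.
move=> e0; apply: contra_neqT; rewrite -ltNge ltr_norml => /andP[? ?].
by rewrite /soft_threshold; case: ger0P => ?; case: ger0P => ?; lra.
Qed.

Lemma continuous_soft_threshold (R : realType) (e : R) :
  continuous (soft_threshold e).
Proof.
move=> t; apply: cvgD; first exact: cvg_id.
apply: cvgMl; apply: cvgB; apply: cvg_norm.
  by apply: cvgB; [exact: cvg_id|exact: cvg_cst].
by apply: cvgD; [exact: cvg_id|exact: cvg_cst].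
Qed.

(** The constants [|e|] and [|- e|] attached to the two shifted absolute values cancel. *)
Lemma uclosed_subalgebra_soft_threshold (R : realType) (X : topologicalType)
    (A : set (X -> R)) (f : X -> R) (e : R) :
  uclosed_subalgebra A -> A f -> A (soft_threshold e \o f).
Proof.
move=> ucA Af; have Ae := uclosed_subalgebra_abs ucA e Af.
have /(uclosed_subalgebra_lin ucA (-1))/(_ Ae) :=
  uclosed_subalgebra_abs ucA (- e) Af.
move=> /(uclosed_subalgebra_lin ucA 2^-1)/(_ Af) H.
congr (A _): H; apply/funext => x; rewrite /= /soft_threshold normrN opprK.
by field.
Qed.

(** The support is a closed subset of the set where [e <= |f|], which is closed by continuity and
    compact by [C0]. *)
Lemma Cc_soft_threshold (R : realType) (X : topologicalType) (f : X -> R)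
    (e : R) : C0 f -> 0 < e -> Cc (soft_threshold e \o f).
Proof.
move=> [cf f0] e0; split.
  move=> x; apply: continuous_comp; first exact: cf.
  exact: continuous_soft_threshold.
apply: subclosed_compact (f0 _ e0) _; first exact: closed_closure.
have /closure_id -> : closed [set x | e <= `|f x|].
  apply: (@preimage_closed _ _ (fun x => `|f x|) [set y : R | e <= y]).
    by move=> x _; apply: cvg_norm; exact: cf.
  exact: closed_ge.
by apply: closureS => x; exact: soft_threshold_neq0.
Qed.

Lemma unorm_le (X : Type) (R : realType) (f : X -> R) (e : R) : 0 <= e ->
  (forall x, `|f x| <= e) -> unorm f <= e.
Proof.
move=> e0 fe; rewrite /unorm; set E := (X in sup X).
(* For empty [X] the supremum takes its default value 0, and [0 <= e] concludes. *)
have [->|/set0P E0] := eqVneq E set0; first by rewrite sup0.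
by apply: ge_sup => // _ [x _ <-].
Qed.

Lemma disjoint_funrposB (X : Type) (R : realType) (f g : X -> R) :
  f * g = 0 -> (forall x, 0 <= f x) -> (forall x, 0 <= g x) ->
  (f - g)^\+ = f.
Proof.
move=> fg f0 g0; apply/funext => x.
have /eqP : f x * g x = 0 := congr1 (@^~ x) fg.
rewrite mulf_eq0 -[LHS]/(Num.max (f x - g x) 0) => /orP[] /eqP E; rewrite E.
  by rewrite sub0r max_r// oppr_le0.
by rewrite subr0 max_l.
Qed.

Theorem lemma19 (R : realType) (X : topologicalType)
    (X_lc : locally_compact [set: X]) (X_haus : hausdorff_space X)
    (X_conn : connected [set: X]) :
  [/\ (* s1 *)
      forall (f : X -> R) (delta : R), Cb f -> (forall x, 0 <= f x) ->
        0 < delta -> Salg f (f \min cst delta),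
      (* s2 *)
      [/\ forall f g : X -> R, Cb f -> Cb g -> f * g = 0 ->
            (forall x, 0 <= f x) -> (forall x, 0 <= g x) ->
            Salg (f - g) f /\ Salg (f - g) g,
          forall f g : X -> R, Cb f -> Cb g -> f * g = 0 ->
            (forall x, 0 <= f x) -> (forall x, g x <= 0) ->
            Salg (f + g) f /\ Salg (f + g) g &
          forall f : X -> R, Cb f ->
            [/\ Salg f (f^\+), Salg f (f^\-) & Salg f (fun x => `|f x|)]],
      (* s3 *)
      forall (f : X -> R) (eps : R), C0 f -> 0 < eps ->
        exists h : X -> R, [/\ Cc h, Salg f h & unorm (f - h) <= eps] &
      (* s4 *)
      forall (f g : X -> R) (c : R), Cb f -> Cb g ->
        (forall x, 0 <= g x /\ g x <= f x /\ f x <= c) ->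
        (forall x, 0 < g x -> f x = c) ->
        Salg (f + g) f /\ Salg (f + g) g].
Proof.
(* Membership in [Salg] is checked in each closed subalgebra containing the generator. Here [f] is
   the positive part of [f - g], and [g = f - (f - g)]. *)
have S2 (f g : X -> R) : f * g = 0 -> (forall x, 0 <= f x) ->
    (forall x, 0 <= g x) -> Salg (f - g) f /\ Salg (f - g) g.
  move=> fg f0 g0; have fE := disjoint_funrposB fg f0 g0.
  have Sf : Salg (f - g) f.
    by move=> A [ucA /(_ _ erefl)/(uclosed_subalgebra_funrpos ucA)]; rewrite fE.
  split=> // A SA; have [ucA /(_ _ erefl) Ad] := SA.
  have := uclosed_subalgebra_sub ucA (Sf _ SA) Ad.
  by rewrite opprB addrC subrK.
split.
- move=> f d _ _ d0 A [ucA /(_ f erefl)].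
  exact: uclosed_subalgebra_min (ltW d0).
- split.
  + by move=> f g _ _; exact: S2.
  + move=> f g _ _ fg f0 g0; rewrite -[g in Salg (f + g)]opprK.
    have [||Sf Sg] := S2 f (- g) _ f0; first by rewrite mulrN fg oppr0.
      by move=> x; rewrite oppr_ge0.
    split=> // A SA; have [ucA _] := SA.
    have := uclosed_subalgebra_scale ucA (-1) (Sg _ SA).
    by congr (A _); apply/funext => x; rewrite mulN1r opprK.
  + move=> f _; split=> A [ucA /(_ f erefl)].
    * exact: uclosed_subalgebra_funrpos.
    * exact: uclosed_subalgebra_funrneg.
    * exact: uclosed_subalgebra_norm.
- move=> f e f0 e0; exists (soft_threshold e \o f); split.
  + exact: Cc_soft_threshold.
  + move=> A [ucA /(_ f erefl)]; exact: uclosed_subalgebra_soft_threshold.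
  + by apply: unorm_le (ltW e0) _ => x; exact: soft_threshold_dist.
- move=> f g c _ _ gfc gc.
  (* A negative [c] forces [X] to be empty, and then all functions on [X] coincide. *)
  have [c0|c0] := leP 0 c; last first.
    have X0 (x : X) : False by have [] := gfc x; lra.
    by split=> A [_ /(_ _ erefl)]; congr (A _); apply/funext => x; case: (X0 x).
  (* Where [g > 0], [f = c] and the sum is truncated to [c]; elsewhere [g = 0] and [f <= c]. *)
  have fE : (fun x => Num.min ((f + g) x) c) = f.
    apply/funext => x; rewrite -[LHS]/(Num.min (f x + g x) c).
    have [g0 [_ fc]] := gfc x; have [gx|gx] := ltP 0 (g x).
      by rewrite (gc _ gx) min_r// lerDl.
    by have -> : g x = 0; [exact/le_anti/andP|rewrite addr0 min_l].
  have Sf : Salg (f + g) f.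
    by move=> A [ucA /(_ _ erefl)/(uclosed_subalgebra_min ucA c0)]; rewrite fE.
  split=> // A SA; have [ucA /(_ _ erefl) Ad] := SA.
  by have := uclosed_subalgebra_sub ucA Ad (Sf _ SA); rewrite addrC addKr.
Qed.
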